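(* With \[ \vartheta_4(a_0,a_1,a_2,a_3):=\frac{1}{4J_4}\Big[a_0\overline{J}_{4,8}\overline{J}_{6,16}+a_1q^2\overline{J}_{0,8}\overline{J}_{14,16}+a_2q\overline{J}_{4,8}\overline{J}_{14,16}+a_3q\overline{J}_{0,8}\overline{J}_{6,16}\Big], \] we have \begin{align*} D_C(0,4)&=\vartheta_4(3,-1,1,-3),\\ D_C(1,4)=D_C(3,4)&=\vartheta_4(-1,-1,1,1),\\ D_C(2,4)&=\vartheta_4(-1,3,-3,1). \end{align*}
   Context: Throughout, $q$ is a complex number with $0<|q|<1$. Write $(x)_\infty=(x;q)_\infty=\prod_{i\ge0}(1-q^ix)$. Let $j(x;q)=(x)_\infty(q/x)_\infty(q)_\infty=\sum_{n\in\mathbb Z}(-1)^nq^{\binom n2}x^n$. For integers $a$ and $m\ge1$: $J_{a,m}=j(q^a;q^m)$, $\overline{J}_{a,m}=j(-q^a;q^m)$, and $J_m=J_{m,3m}=\prod_{i\ge1}(1-q^{mi})$. Cranks: define integers $C(m,n)$ ($m\in\mathbb Z$, $n\ge0$) by $\sum_{n\ge0}\sum_{m\in\mathbb Z}C(m,n)z^mq^n=\prod_{n\ge1}\frac{1-q^n}{(1-zq^n)(1-z^{-1}q^n)}$. For $n\ge2$, $C(m,n)$ is the number of partitions $\pi$ of $n$ with crank $m$, where the crank of $\pi$ is its largest part if $\pi$ has no parts equal to $1$, and otherwise $\mu(\pi)-\nu(\pi)$ with $\nu(\pi)$ the number of ones and $\mu(\pi)$ the number of parts larger than $\nu(\pi)$;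 for $n\le1$ the generating function gives $C(0,0)=1$, $C(1,1)=C(-1,1)=1$, $C(0,1)=-1$, all other values $0$. For $M\ge1$ and integer $a$, $C(a,M;n)=\sum_{m\equiv a\pmod M}C(m,n)$. Let $p(n)$ be the number of partitions of $n$ ($p(0)=1$). The crank deviation is $D_C(a,M)=\sum_{n\ge0}\big(C(a,M;n)-p(n)/M\big)q^n$. *)

(* Defs.v *)
(* q-series are handled as FORMAL power series in q with
   rational coefficients (a series is its coefficient function nat -> rat). *)
From HB Require Import structures.
From mathcomp Require Import all_boot all_order all_algebra.
Set Implicit Arguments. Unset Strict Implicit. Unset Printing Implicit Defensive.
Import Order.TTheory GRing.Theory Num.Theory.

Definition ser := nat -> rat.

Local Open Scope ring_scope.

Definition sscale (c : rat) (f : ser) : ser := fun n => c * f n.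
Definition sadd (f g : ser) : ser := fun n => f n + g n.
Definition smul (f g : ser) : ser :=
  fun n => \sum_(i < n.+1) f i * g (n - i)%N.
Definition sshift (k : nat) (f : ser) : ser :=
  fun n => if (k <= n)%N then f (n - k)%N else 0.

Fixpoint sinv_upto (f : ser) (n : nat) : seq rat :=
  match n with
  | 0 => [:: (f 0%N)^-1]
  | m.+1 => let s := sinv_upto f m in
            rcons s (- (f 0%N)^-1 *
                       \sum_(k < m.+1) f k.+1 * nth 0 s (m - k)%N)
  end.
Definition sinv (f : ser) : ser := fun n => nth 0 (sinv_upto f n) n.

(* ---------- theta functions ----------
   jser s a m  is  j(x; q^m)  with  x = q^a  (s = false)  or  x = -q^a (s = true),
   expanded via  j(x;q^m) = sum_{n in Z} (-1)^n q^{m n(n-1)/2} x^n.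
   The coefficient of q^N collects the n with m n(n-1)/2 + a n = N; for
   0 <= a <= m (the only case used) all such n lie in [-(N+1), N+1]. *)
Definition jser (s : bool) (a m : nat) : ser :=
  fun N => \sum_(k < (2 * N + 3)%N)
     let n : int := (k%:Z - (N.+1)%:Z)%R in
     if (m%:Z * n * (n - 1) + 2 * a%:Z * n == 2 * N%:Z)%R
     then (if s then 1 else (-1) ^+ `|n|%N) else 0.

Definition Jam (a m : nat) : ser := jser false a m.
Definition Jbar (a m : nat) : ser := jser true a m.
Definition Jm (m : nat) : ser := Jam m (3 * m).

Definition theta4 (a0 a1 a2 a3 : rat) : ser :=
  sscale (1 / 4) (smul (sinv (Jm 4))
   (sadd (sadd (sscale a0 (smul (Jbar 4 8) (Jbar 6 16)))
               (sscale a1 (sshift 2 (smul (Jbar 0 8) (Jbar 14 16)))))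
         (sadd (sscale a2 (sshift 1 (smul (Jbar 4 8) (Jbar 14 16))))
               (sscale a3 (sshift 1 (smul (Jbar 0 8) (Jbar 6 16))))))).

(* ---------- partitions and cranks ----------
   A partition of n is encoded by its multiplicity function
   mu : 'I_(n+1) -> 'I_(n+1)  (mu i = number of parts equal to i),
   with mu 0 = 0 and sum_i i * mu i = n. *)
Definition is_ptn (n : nat) (mu : {ffun 'I_n.+1 -> 'I_n.+1}) : bool :=
  (nat_of_ord (mu ord0) == 0%N) && (\sum_(i < n.+1) i * mu i == n)%N.

Definition nones (n : nat) (mu : {ffun 'I_n.+1 -> 'I_n.+1}) : nat :=
  (\sum_(i < n.+1 | nat_of_ord i == 1%N) mu i)%N.
Definition lpart (n : nat) (mu : {ffun 'I_n.+1 -> 'I_n.+1}) : nat :=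
  (\max_(i < n.+1 | (0 < mu i)%N) i)%N.
Definition nbig (n : nat) (mu : {ffun 'I_n.+1 -> 'I_n.+1}) : nat :=
  (\sum_(i < n.+1 | (nones mu < i)%N) mu i)%N.

Definition crank (n : nat) (mu : {ffun 'I_n.+1 -> 'I_n.+1}) : int :=
  if nones mu == 0%N then (lpart mu)%:Z
  else (nbig mu)%:Z - (nones mu)%:Z.

Definition npart (n : nat) : nat := #|[set mu : {ffun 'I_n.+1 -> 'I_n.+1} | is_ptn mu]|.

Definition cong (x a : int) (M : nat) : bool := ((x - a) %% M%:Z)%Z == 0.

(* C(a,M;n) = sum_{m = a mod M} C(m,n); for n <= 1 from the generating
   function (C(0,0)=1; C(1,1)=C(-1,1)=1, C(0,1)=-1), for n >= 2 by counting
   partitions of n by crank. *)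
Definition CaM (a : int) (M n : nat) : int :=
  if n == 0%N then (cong 0 a M)%:Z
  else if n == 1%N then (cong 1 a M)%:Z + (cong (-1) a M)%:Z - (cong 0 a M)%:Z
  else (#|[set mu : {ffun 'I_n.+1 -> 'I_n.+1} | is_ptn mu && cong (crank mu) a M]|)%:Z.

Definition DC (a : int) (M : nat) : ser :=
  fun n => (CaM a M n)%:~R - (npart n)%:R / M%:R.

(* Main.v *)
(* For a unit [z] put [G(z) = prod_(i >= 1) (1 - x^i) / ((1 - z x^i)(1 - z^-1 x^i))].
   Filtering residues mod 4 by powers of ['i] turns the crank deviations into
   combinations of [G(-1)] and [G('i) = G(-'i)]; the term [z = 1] is the one that
   [p(n)/4] cancels.  The triple product gives
     [j(-q^4;q^8) - q j(-1;q^8) = sum_k (-1)^k q^(k^2)] and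
     [j(-q^6;q^16) + s q j(-q^14;q^16) = sum_k s^k q^(2 k^2 - k)] for [s = 1, -1],
   and [J_4 G(-1)], [J_4 G('i)] are the products of the first of these series with
   the second for [s = -1] and [s = 1] respectively.

   That [G] counts cranks is the Andrews-Garvan theorem: expand [G(z)] by Cauchy's
   q-binomial theorem and read the [m]-th summand as the partitions with exactly
   [m] ones; the summand without ones is expanded by Euler's formula according to
   the largest part.

   To prove an identity between [n]-th coefficients we compute in [K[X]/X^(n+1)],
   where the variable [x] is nilpotent: all infinite products are finite and all
   their inverses exist. *)
Require Import Defs.
From HB Require Import structures.
From mathcomp Require Import all_boot all_order all_algebra all_field.
From mathcomp Require Import zify ring.
From Stdlib Require Import FunctionalExtensionality.
Set Implicit Arguments. Unset Strict Implicit. Unset Printing Implicit Defensive.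
Import Order.TTheory GRing.Theory Num.Theory.
Local Open Scope ring_scope.

(** * Finite triple product *)

Definition qpoch {A : comNzRingType} (a q : A) (n : nat) : A :=
  \prod_(i < n) (1 - a * q ^+ i).

Lemma qpochS {A : comNzRingType} (a q : A) n :
  qpoch a q n.+1 = qpoch a q n * (1 - a * q ^+ n).
Proof. exact: big_ord_recr. Qed.

Lemma qpoch_recl {A : comNzRingType} (a q : A) n :
  qpoch a q n.+1 = (1 - a) * qpoch (a * q) q n.
Proof.
rewrite /qpoch big_ord_recl expr0 mulr1; congr (_ * _).
by apply: eq_bigr => i _; rewrite exprS mulrA.
Qed.

(** Gaussian binomials by Pascal's rule, which needs no division. Where the natural subtraction
    [n' - k'] truncates, the coefficient next to it is zero. *)
Fixpoint qbin {A : comNzRingType} (q : A) (n k : nat) : A :=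
  match n, k with
  | _, 0 => 1
  | 0, _.+1 => 0
  | n'.+1, k'.+1 => qbin q n' k + q ^+ (n' - k') * qbin q n' k'
  end.

Lemma qbinS {A : comNzRingType} (q : A) n k :
  qbin q n.+1 k.+1 = qbin q n k.+1 + q ^+ (n - k) * qbin q n k.
Proof. by []. Qed.

Lemma qbin0 {A : comNzRingType} (q : A) n : qbin q n 0 = 1.
Proof. by case: n. Qed.

Lemma qbin_small {A : comNzRingType} (q : A) n k : (n < k)%N -> qbin q n k = 0.
Proof.
elim: n k => [|n IHn] [|k] //= ltnk.
by rewrite !IHn ?mulr0 ?addr0 // ltnW.
Qed.

(** The mirrored Pascal rule. In the finite triple product a new factor in [v] calls for this one, a
    new factor in [u] for [qbinS]. *)
Lemma qbinS_alt {A : comNzRingType} (q : A) n k :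
  qbin q n.+1 k.+1 = qbin q n k + q ^+ k.+1 * qbin q n k.+1.
Proof.
elim: n k => [|n IHn] k.
  by case: k => [|k] /=; rewrite ?subn0 ?expr0; ring.
have [lenk|ltkn] := leqP n.+1 k.
  rewrite qbinS (@qbin_small _ _ n.+1 k.+1) ?ltnS //.
  have -> : (n.+1 - k = 0)%N by apply/eqP.
  by rewrite expr0; ring.
rewrite (qbinS q n.+1) [in LHS]IHn (qbinS q n k).
case: k ltkn => [|k] ltkn.
  by rewrite !qbin0 !subn0 !exprS; ring.
rewrite [in LHS]IHn (qbinS q n k) subSS -(subnSK (ltkn : (k < n)%N)) !exprS; ring.
Qed.

Lemma qbin_qpoch {A : comNzRingType} (q : A) n k : (k <= n)%N ->
  qbin q n k * qpoch q q k * qpoch q q (n - k) = qpoch q q n.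
Proof.
elim: n k => [|n IHn] [|k] // lekn; rewrite ?subn0.
- by rewrite /= /qpoch !big_ord0 !mul1r.
- by rewrite qbin0 {1}/qpoch big_ord0 !mul1r.
rewrite subSS qbinS !qpochS.
have := IHn k lekn; have [<- IHk|nekn IHk] := eqVneq k n.
  rewrite (@qbin_small _ _ k k.+1) // subnn expr0 -[in RHS]IHk subnn; ring.
have ltkn : (k < n)%N by lia.
have IHk1 := IHn _ ltkn; rewrite qpochS in IHk1.
have qnE : qpoch q q (n - k) = qpoch q q (n - k.+1) * (1 - q ^+ (n - k)).
  by rewrite -(subnSK ltkn) qpochS exprS.
have -> : q * q ^+ n = q ^+ (n - k) * (q * q ^+ k).
  by rewrite -!exprS -exprD; congr (_ ^+ _); lia.
(* Splits [1 - q^(n+1)] as [(1 - q^(n-k)) + q^(n-k) (1 - q^(k+1))], one part for each Pascal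
   term. *)
transitivity (qpoch q q n * (1 - q ^+ (n - k)) +
              q ^+ (n - k) * (1 - q * q ^+ k) * qpoch q q n); last ring.
by rewrite -{1}IHk1 -IHk qnE; ring.
Qed.

Arguments qbin : simpl never.

(** Since [k (k + 1)] is even and non-negative for every integer [k], neither the absolute value nor
    the division loses anything. *)
Definition tri (k : int) : nat := (`|(k * (k + 1))%R| %/ 2)%N.

Lemma triE k : (tri k)%:Z * 2 = k * (k + 1).
Proof.
rewrite /tri; have e : exists m : int, k * (k + 1) = m * 2.
  have [m [E|E]] : exists m : int, k = m * 2 \/ k = m * 2 + 1.
    by exists (divz k 2); lia.
  - by exists (m * (k + 1)); rewrite {1}E; ring.
  - by exists (k * (m + 1)); rewrite {2}E; ring.
have ge0 : 0 <= k * (k + 1) by nia.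
case: e => m E; rewrite E in ge0 *; lia.
Qed.

Lemma triS k : (tri (k + 1))%:Z = (tri k)%:Z + k + 1.
Proof.
apply: (@mulIf _ 2) => //; rewrite !mulrDl !triE; ring.
Qed.

Lemma triN k : (tri (- k))%:Z = (tri k)%:Z - k.
Proof.
apply: (@mulIf _ 2) => //; rewrite mulrBl !triE; ring.
Qed.

(* Ramanujan's [f(u, v)] has the terms [u^(k(k+1)/2) v^(k(k-1)/2)]; taking
   [u v] as the base avoids the negative powers of [u] in [j(-u; uv)]. *)
Definition theta_term {A : comNzRingType} (u v : A) (k : int) : A :=
  u ^+ tri k * v ^+ tri (- k).

(** Consecutive terms have ratio [u (u v)^k]; as [k] may be negative, both sides carry a power of
    [u v] that keeps the exponents natural. *)
Lemma theta_term_up {A : comNzRingType} (u v : A) (a m : nat) (k : int) :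
  m%:Z = a%:Z - k ->
  u * (u * v) ^+ a * theta_term u v k = (u * v) ^+ m * theta_term u v (k + 1).
Proof.
move=> mE; rewrite /theta_term !exprMn !mulrA.
have e1 : (a.+1 + tri k = m + tri (k + 1))%N.
  by move: (triS k); move: (tri (k + 1)) (tri k) => s t; lia.
have e2 : (a + tri (- k) = m + tri (- (k + 1)))%N.
  move: (triN k) (triN (k + 1)) (triS k).
  by move: (tri (- k)) (tri (- (k + 1))) (tri (k + 1)) (tri k) => s t s1 t1; lia.
transitivity (u ^+ (a.+1 + tri k) * v ^+ (a + tri (- k))).
  by rewrite !exprD exprS; ring.
by rewrite e1 e2 !exprD; ring.
Qed.

Lemma theta_termC {A : comNzRingType} (u v : A) k :
  theta_term u v (- k) = theta_term v u k.
Proof. by rewrite /theta_term opprK mulrC. Qed.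

Lemma theta_term_down {A : comNzRingType} (u v : A) (b m : nat) (k : int) :
  m%:Z = b%:Z + k ->
  v * (u * v) ^+ b * theta_term u v k = (u * v) ^+ m * theta_term u v (k - 1).
Proof.
move=> mE; have := @theta_term_up A v u b m (- k).
rewrite (_ : - k + 1 = - (k - 1)); last by lia.
by rewrite !theta_termC (mulrC v u) => -> //; lia.
Qed.

(** Induction on [b] with [a = 0], then on [a]. A new factor turns each term into itself plus a
    multiple of its neighbour, and Pascal's rule collects the pieces. *)
Lemma finite_triple_product {A : comNzRingType} (u v : A) (a b : nat) :
  (\prod_(i < a) (1 + u * (u * v) ^+ i)) * (\prod_(i < b) (1 + v * (u * v) ^+ i))
  = \sum_(j < (a + b).+1) qbin (u * v) (a + b) j * theta_term u v (j%:Z - b%:Z).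
Proof.
set q := u * v; elim: a => [|a IHa].
  rewrite big_ord0 mul1r add0n; elim: b => [|b IHb].
    by rewrite big_ord0 big_ord_recl big_ord0 qbin0 /theta_term /tri /= mulr1 mul1r addr0.
  rewrite big_ord_recr /= {}IHb mulrDr mulr1.
  rewrite [RHS]big_ord_recl qbin0.
  under [X in _ = _ + X]eq_bigr => j _ do rewrite lift0 qbinS_alt mulrDl.
  rewrite big_split /= addrCA; congr (_ + _).
    by apply: eq_bigr => j _; congr (_ * theta_term _ _ _); lia.
  rewrite mulr_suml big_ord_recl [X in _ = _ + X]big_ord_recr /=.
  rewrite (@qbin_small _ _ b b.+1) // mulr0 mul0r addr0; congr (_ + _).
    rewrite !qbin0 !mul1r mulrC (@theta_term_down _ _ _ _ 0) ?expr0 ?mul1r; last by lia.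
    by congr theta_term; lia.
  apply: eq_bigr => j _; rewrite /bump leq0n add1n -[RHS]mulrA [in RHS]mulrCA -mulrA.
  congr (_ * _); rewrite mulrC (@theta_term_down _ _ _ _ j.+1); last by lia.
  by congr (_ * theta_term _ _ _); lia.
rewrite big_ord_recr /= mulrAC {}IHa mulrDr mulr1 addSn.
rewrite [RHS]big_ord_recl qbin0.
under [X in _ = _ + X]eq_bigr => j _ do rewrite lift0 qbinS mulrDl.
rewrite big_split /= addrA; congr (_ + _).
  by rewrite big_ord_recl [X in _ = _ + X]big_ord_recr /= qbin0
     (@qbin_small _ _ (a + b) (a + b).+1) // mul0r addr0.
rewrite mulr_suml; apply: eq_bigr => j _.
rewrite -[RHS]mulrA [in RHS]mulrCA -mulrA; congr (_ * _).
rewrite mulrC (@theta_term_up _ _ _ _ (a + b - j)); last by have := ltn_ord j; lia.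
by congr (_ * theta_term _ _ _); lia.
Qed.

(** * Triple product with a nilpotent base *)

Definition isum {A : nmodType} (f : int -> A) (L : nat) : A :=
  \sum_(j < L.*2.+1) f (j%:Z - L%:Z).

Lemma isum0 {A : nmodType} (f : int -> A) : isum f 0 = f 0.
Proof. by rewrite /isum big_ord_recl big_ord0 addr0. Qed.

Lemma isumS {A : nmodType} (f : int -> A) L :
  isum f L.+1 = isum f L + f L.+1%:Z + f (- L.+1%:Z).
Proof.
rewrite /isum doubleS big_ord_recl addrC big_ord_recr /=; congr (_ + _ + _).
- by apply: eq_bigr => i _; congr f; rewrite /bump /=; lia.
- by congr f; rewrite /bump /=; lia.
- by congr f; lia.
Qed.

Lemma eq_isum {A : nmodType} (f g : int -> A) L : f =1 g -> isum f L = isum g L.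
Proof. by move=> fg; apply: eq_bigr. Qed.

Lemma isumZ {A : pzSemiRingType} (c : A) (f : int -> A) L :
  isum (fun k => c * f k) L = c * isum f L.
Proof. by rewrite /isum mulr_sumr. Qed.

Lemma isumN {A : nmodType} (f : int -> A) L : isum (fun k => f (- k)) L = isum f L.
Proof.
elim: L => [|L IHL]; first by rewrite !isum0 oppr0.
by rewrite !isumS IHL opprK addrAC.
Qed.

(** For [|k| <= L] the odd indices [2k + 1] run from [-2L + 1] to [2L + 1], hence the one extra
    term. *)
Lemma isum_double {A : nmodType} (f : int -> A) L :
  isum f L.*2 + f L.*2.+1%:Z =
  isum (fun k => f (k * 2)) L + isum (fun k => f (k * 2 + 1)) L.
Proof.
elim: L => [|L IHL]; first by rewrite !isum0.
rewrite doubleS !isumS IHL.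
have -> : L.+1%:Z * 2 = L.*2.+2%:Z by lia.
have -> : - L.+1%:Z * 2 = - L.*2.+2%:Z by lia.
have -> : L.*2.+2%:Z + 1 = L.*2.+3%:Z by lia.
have -> : - L.*2.+2%:Z + 1 = - L.*2.+1%:Z by lia.
by rewrite !addrA [LHS](ACl (1*4*5*2*6*3)%AC).
Qed.

Lemma unitr_1Bnilp {A : comUnitRingType} (y : A) n :
  y ^+ n = 0 -> 1 - y \is a GRing.unit.
Proof.
move=> yn0; apply/unitrPr; exists (\sum_(i < n) y ^+ i).
by apply: oppr_inj; rewrite -mulNr opprB -subrX1 yn0 add0r.
Qed.

Lemma geom_nilp {A : comUnitRingType} (y : A) n :
  y ^+ n = 0 -> \sum_(i < n) y ^+ i = (1 - y)^-1.
Proof.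
move=> yn0; apply: (mulrI (unitr_1Bnilp yn0)); rewrite mulrV ?(unitr_1Bnilp yn0) //.
by apply: oppr_inj; rewrite -mulNr opprB -subrX1 yn0 add0r.
Qed.

Lemma expr_nilp {A : pzSemiRingType} (x : A) N n :
  x ^+ N = 0 -> (N <= n)%N -> x ^+ n = 0.
Proof. by move=> xN0 leNn; rewrite -(subnKC leNn) exprD xN0 mul0r. Qed.

Lemma prod_trunc {A : comNzRingType} (f : nat -> A) N L :
  (forall i, (N <= i)%N -> f i = 1) -> (N <= L)%N ->
  \prod_(i < L) f i = \prod_(i < N) f i.
Proof.
move=> f1 leNL; rewrite -(subnKC leNL) big_split_ord /=.
by rewrite [X in _ * X]big1 ?mulr1 // => i _; rewrite f1 ?leq_addr.
Qed.

Lemma qpoch_trunc {A : comNzRingType} (a q : A) N L :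
  q ^+ N = 0 -> (N <= L)%N -> qpoch a q L = qpoch a q N.
Proof.
move=> qN0; apply: (@prod_trunc _ (fun i => 1 - a * q ^+ i)) => i leNi.
by rewrite (expr_nilp qN0 leNi) mulr0 subr0.
Qed.

Lemma prodr_unit {A : comUnitRingType} n (f : nat -> A) :
  (forall i, f i \is a GRing.unit) -> \prod_(i < n) f i \is a GRing.unit.
Proof. by move=> fu; elim/big_rec: _ => [|i y _ yu]; rewrite ?unitr1 // unitrM fu. Qed.

Lemma qpoch_unit {A : comUnitRingType} (a q : A) N n :
  a ^+ N = 0 -> qpoch a q n \is a GRing.unit.
Proof.
move=> aN0; apply: (@prodr_unit _ n (fun i => 1 - a * q ^+ i)) => i.
by apply: (@unitr_1Bnilp _ _ N); rewrite exprMn aN0 mul0r.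
Qed.

(** The finite identity for [a = b = L]. Factors from index [N] on are 1 and terms with [|k| >= N]
    vanish. For the other terms [L + k] and [L - k] are at least [N], which makes the Gaussian
    binomial the inverse of [qpoch q q N]. *)
Lemma triple_product_nilp {A : comUnitRingType} (u v : A) N L :
    (forall m n, (N <= m + n)%N -> u ^+ m * v ^+ n = 0) -> (N.*2 <= L)%N ->
  (\prod_(i < N) (1 + u * (u * v) ^+ i)) * (\prod_(i < N) (1 + v * (u * v) ^+ i))
    * (\prod_(i < N) (1 - (u * v) ^+ i.+1)) = isum (theta_term u v) L.
Proof.
move=> uv0 leNL; set q := u * v.
have leNL' : (N <= L)%N by lia.
have qN0 : q ^+ N = 0 by rewrite exprMn uv0 ?leq_addr.
have qu n : qpoch q q n \is a GRing.unit by apply: qpoch_unit qN0.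
have -> : \prod_(i < N) (1 - q ^+ i.+1) = qpoch q q N.
  by apply: eq_bigr => i _; rewrite exprS.
rewrite -(@prod_trunc _ (fun i => 1 + u * q ^+ i) N L) //; last first.
  by move=> i leNi; rewrite (expr_nilp qN0 leNi) mulr0 addr0.
rewrite -(@prod_trunc _ (fun i => 1 + v * q ^+ i) N L) //; last first.
  by move=> i leNi; rewrite (expr_nilp qN0 leNi) mulr0 addr0.
rewrite finite_triple_product mulr_suml /isum addnn; apply: eq_bigr => j _.
have [far|near] := leqP N `|j%:Z - L%:Z|%N.
  suff -> : theta_term u v (j%:Z - L%:Z) = 0 by rewrite mulr0 mul0r.
  (* The exponents of [u] and [v] add up to [k^2 >= |k| >= N]. *)
  apply: uv0; move: (triE (j%:Z - L%:Z)) (triN (j%:Z - L%:Z)).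
  by move: (tri _) (tri _) far; move: (j%:Z - L%:Z) => k s t far; nia.
have lt_j := ltn_ord j.
have := @qbin_qpoch _ q L.*2 j; rewrite -ltnS lt_j => /(_ isT).
rewrite !(@qpoch_trunc _ q q N) //; try lia.
move=> e; apply: (mulIr (qu N)); rewrite -[in RHS]e; ring.
Qed.

(** * Theta series of a nilpotent variable *)

Lemma prod_split2 {A : comPzSemiRingType} (f : nat -> A) n :
  \prod_(i < n.*2) f i = (\prod_(i < n) f (i.*2)) * (\prod_(i < n) f (i.*2.+1)).
Proof.
elim: n => [|n IHn]; first by rewrite !big_ord0 mulr1.
by rewrite doubleS !big_ord_recr /= IHn (ACl (1*3*2*4)%AC) !mulrA.
Qed.

Lemma prod_split3 {A : comPzSemiRingType} (f : nat -> A) n :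
  \prod_(i < 3 * n) f i = (\prod_(i < n) f (3 * i)%N) *
    (\prod_(i < n) f (3 * i).+1) * (\prod_(i < n) f (3 * i).+2).
Proof.
elim: n => [|n IHn]; first by rewrite !big_ord0 !mulr1.
by rewrite (_ : 3 * n.+1 = (3 * n).+3)%N ?mulnS // !big_ord_recr /= IHn
  (ACl (1*4*2*5*3*6)%AC) !mulrA.
Qed.

(* For [x] nilpotent of order [N] this is the infinite product of the [1 + s x^(m i + r)]. *)
Definition nprod {A : comNzRingType} (x : A) (N : nat) (s : A) (m r : nat) : A :=
  \prod_(i < N) (1 + s * x ^+ (m * i + r)).

Section Nilpotent.
Variables (A : comUnitRingType) (x : A) (N : nat).
Hypothesis xN0 : x ^+ N = 0.
Local Notation P := (nprod x N).

Lemma nprod_trunc s m r L : (0 < m)%N -> (N <= L)%N ->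
  P s m r = \prod_(i < L) (1 + s * x ^+ (m * i + r)).
Proof.
move=> m_gt0 leNL; rewrite (@prod_trunc _ (fun i => 1 + s * x ^+ (m * i + r)) N L) //.
move=> i leNi; rewrite (expr_nilp xN0) ?mulr0 ?addr0 //.
by rewrite (leq_trans leNi) // (leq_trans (leq_pmull i m_gt0)) ?leq_addr.
Qed.

Lemma nprod_unit s m r : (0 < r)%N -> P s m r \is a GRing.unit.
Proof.
move=> r_gt0; apply: (@prodr_unit _ N (fun i => 1 + s * x ^+ (m * i + r))) => i.
rewrite -[s]opprK mulNr; apply: (@unitr_1Bnilp _ _ N).
rewrite exprMn -exprM (expr_nilp xN0) ?mulr0 //.
by rewrite leq_pmull // addn_gt0 r_gt0 orbT.
Qed.

Lemma nprod_split2 s m r : (0 < m)%N ->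
  P s m r = P s (2 * m) r * P s (2 * m) (m + r).
Proof.
move=> m_gt0; rewrite (@nprod_trunc s m r N.*2) -?addnn ?leq_addl //.
rewrite addnn (prod_split2 (fun i => 1 + s * x ^+ (m * i + r))).
by congr (_ * _); apply: eq_bigr => i _; congr (_ + _ * _ ^+ _); lia.
Qed.

Lemma nprod_split3 s m r : (0 < m)%N ->
  P s m r = P s (3 * m) r * P s (3 * m) (m + r) * P s (3 * m) (2 * m + r).
Proof.
move=> m_gt0; rewrite (@nprod_trunc s m r (3 * N)) ?leq_pmull //.
rewrite (prod_split3 (fun i => 1 + s * x ^+ (m * i + r))).
by congr (_ * _ * _); apply: eq_bigr => i _; congr (_ + _ * _ ^+ _); lia.
Qed.

Lemma nprod_mulN s m r :
  P s m r * P (- s) m r = P (- (s * s)) (2 * m) (2 * r).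
Proof.
rewrite /nprod -big_split /=; apply: eq_bigr => i _.
by rewrite -mulnA -mulnDr (mulnC 2) exprM; ring.
Qed.

Lemma nprod_triple_product s a b L :
    s * s = 1 -> (0 < a)%N -> (0 < b)%N -> (N.*2 <= L)%N ->
  isum (theta_term (s * x ^+ a) (s * x ^+ b)) L =
  P s (a + b) a * P s (a + b) b * P (- 1) (a + b) (a + b).
Proof.
move=> ss a_gt0 b_gt0 leNL.
have uv : s * x ^+ a * (s * x ^+ b) = x ^+ (a + b).
  by rewrite mulrACA ss mul1r exprD.
rewrite -(@triple_product_nilp _ _ _ N) //; last first.
  move=> m n leN; rewrite !exprMn mulrACA -!exprM -!exprD [X in _ * X](expr_nilp xN0) ?mulr0 //.
  by have := leq_pmull m a_gt0; have := leq_pmull n b_gt0; lia.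
rewrite uv; congr (_ * _ * _); apply: eq_bigr => i _.
- by rewrite -exprM -mulrA -exprD addnC.
- by rewrite -exprM -mulrA -exprD addnC.
- by rewrite -exprM mulN1r mulnS addnC.
Qed.

Local Notation O := (P (- 1) 2 1).
Local Notation Op := (P 1 2 1).
Local Notation J m := (P (- 1) m m).

Lemma nprod_J1 : J 1 = O * J 2.
Proof. exact: nprod_split2. Qed.

(** [O * Op] is the product of the [1 - x^(4i+2)], the factors of [J 2] that [J 4] misses. *)
Lemma nprod_J2 : J 2 = O * Op * J 4.
Proof. by rewrite (mulrC O) nprod_mulN mulr1 -nprod_split2. Qed.

Lemma nprod_distinct1 : P 1 1 1 * J 1 = J 2.
Proof. by rewrite nprod_mulN mulr1. Qed.

Lemma nprod_distinct2 : P 1 2 2 * J 2 = J 4.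
Proof. by rewrite nprod_mulN mulr1. Qed.

(** Euler's pentagonal number theorem in [x^4]: the residues 4, 8 and 0 modulo 12 make up the
    multiples of 4. *)
Lemma theta_pentagonal L : (N.*2 <= L)%N ->
  isum (theta_term (- 1 * x ^+ 4) (- 1 * x ^+ 8)) L = J 4.
Proof.
by move=> leNL; rewrite nprod_triple_product ?mulrNN ?mulr1 // [RHS]nprod_split3.
Qed.

Lemma theta_phi L : (N.*2 <= L)%N ->
  isum (theta_term (- 1 * x ^+ 1) (- 1 * x ^+ 1)) L = O * O * J 2.
Proof. by move=> leNL; rewrite nprod_triple_product ?mulrNN ?mulr1. Qed.

(** The terms are [s^k x^(2k^2-k)]; in the product the residues 1 and 3 modulo 4 merge into all odd
    exponents. *)
Lemma theta_psi s L : s * s = 1 -> (N.*2 <= L)%N ->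
  isum (theta_term (s * x ^+ 1) (s * x ^+ 3)) L = P s 2 1 * J 4.
Proof. by move=> ss leNL; rewrite nprod_triple_product // [P s 2 1]nprod_split2. Qed.

(** The sum of the [(-1)^k x^(k^2)] by parity of the index: [2k] gives [x^(4k^2)], and [2k + 1]
    gives [- x] times [x^(8 tri k)]. *)
Lemma theta_phi_split L : (N.*2 <= L)%N ->
  isum (theta_term (x ^+ 4) (x ^+ 4)) L - x * isum (theta_term 1 (x ^+ 8)) L
  = O * O * J 2.
Proof.
move=> leNL; rewrite -(@theta_phi L.*2); last by lia.
have th k : theta_term (- 1 * x ^+ 1) (- 1 * x ^+ 1) k
    = (- 1) ^+ (tri k + tri (- k)) * x ^+ (tri k + tri (- k)).
  by rewrite /theta_term expr1 !exprMn !exprD; ring.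
have tri2 (k : int) (s : nat) : s%:Z = k * k -> (tri k + tri (- k))%N = s.
  by move: (triE k) (triN k); move: (tri k) (tri (- k)) => t t'; lia.
have := isum_double (theta_term (- 1 * x ^+ 1) (- 1 * x ^+ 1)) L.
(* The extra term of [isum_double] has exponent [(2L+1)^2 >= N], so it vanishes. *)
rewrite [X in _ + X = _ -> _]th (@tri2 _ (L.*2.+1 * L.*2.+1)%N) ?PoszM //.
rewrite [X in _ + _ * X = _ -> _](expr_nilp xN0) ?mulr0 ?addr0; last by nia.
move=> ->; congr (_ + _).
  apply: eq_isum => k; rewrite th /theta_term -!exprM -exprD.
  have := triE k; have := triN k.
  set t := tri k; set t' := tri (- k) => tE t'E.
  rewrite (@tri2 _ (4 * t + 4 * t')%N); last by lia.
  rewrite -signr_odd (_ : odd _ = false) ?mul1r //.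
  by rewrite oddD !oddM.
(* [theta_term 1 (x^8) k] is [x^(8 tri (-k))], so the index is reversed to meet the odd part. *)
rewrite -mulNr -isumZ -isumN; apply: eq_isum => k.
rewrite th /theta_term expr1n mul1r -!exprM opprK.
have := triE k; have := triN k.
set t := tri k; set t' := tri (- k) => tE t'E.
rewrite (@tri2 _ (8 * t + 1)%N); last by nia.
rewrite addn1 [(- 1) ^+ _]exprS -signr_odd oddM mulr1 [x ^+ _.+1]exprS; ring.
Qed.

(** In [theta_psi] the index [2k] has exponent [8k^2 - 2k] and an even power of [s]; the index
    [2k + 1] has exponent [8k^2 + 6k + 1] and an odd power of [s]. *)
Lemma theta_psi_split s L : s * s = 1 -> (N.*2.+2 <= L)%N ->
  isum (theta_term (x ^+ 6) (x ^+ 10)) L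
    + s * x * isum (theta_term (x ^+ 14) (x ^+ 2)) L
  = P s 2 1 * J 4.
Proof.
move=> ss leNL; rewrite -(@theta_psi s L.*2) //; last by lia.
have sE n : s ^+ n = s ^+ odd n.
  rewrite -{1}(odd_double_half n) exprD -muln2 mulnC exprM expr2 ss expr1n mulr1 //.
have th k : theta_term (s * x ^+ 1) (s * x ^+ 3) k
    = s ^+ (tri k + tri (- k)) * x ^+ (tri k + 3 * tri (- k)).
  by rewrite /theta_term expr1 (exprMn _ s x) (exprMn _ s (x ^+ 3)) -exprM [s ^+ (_ + _)]exprD [x ^+ (_ + _)]exprD; ring.
have := isum_double (theta_term (s * x ^+ 1) (s * x ^+ 3)) L.
rewrite [X in _ + X = _ -> _]th.
rewrite [X in _ + _ * X = _ -> _](expr_nilp xN0) ?mulr0 ?addr0; last first.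
  move: (triE L.*2.+1) (triN L.*2.+1).
  by move: (tri _) (tri _) => t t'; nia.
move=> ->; congr (_ + _).
  apply: eq_isum => k; rewrite th sE /theta_term -!exprM -exprD.
  move: (triE k) (triN k) (triE (k * 2)) (triN (k * 2)).
  move: (tri k) (tri (- k)) (tri (k * 2)) (tri (- (k * 2))) => t t' r r' tE t'E rE r'E.
  have -> : odd (r + r') = false by lia.
  by rewrite mul1r; congr (_ ^+ _); nia.
rewrite -isumZ; apply: eq_isum => k.
rewrite th sE /theta_term -!exprM -exprD -mulrA -exprS.
move: (triE k) (triN k) (triE (k * 2 + 1)) (triN (k * 2 + 1)).
move: (tri k) (tri (- k)) (tri (k * 2 + 1)) (tri (- (k * 2 + 1))) => t t' r r' tE t'E rE r'E.
have -> : odd (r + r') = true by lia.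
by rewrite expr1; congr (_ * _ ^+ _); nia.
Qed.
End Nilpotent.

(** * Truncated power series *)

Lemma isum_trunc {A : nmodType} (f : int -> A) N L :
  (forall k : int, (N < `|k|)%N -> f k = 0) -> (N <= L)%N -> isum f L = isum f N.
Proof.
move=> f0 /subnKC <-; elim: (L - N)%N => [|d IHd]; first by rewrite addn0.
by rewrite addnS isumS IHd !f0 ?addr0 //; lia.
Qed.

Lemma size_sinv_upto f n : size (sinv_upto f n) = n.+1.
Proof. by elim: n => //= n IHn; rewrite size_rcons IHn. Qed.

(** Each stage only appends an entry, so [sinv] inherits the recurrence of the list. *)
Lemma nth_sinv_upto f n i : (i <= n)%N -> nth 0 (sinv_upto f n) i = sinv f i.
Proof.
elim: n => [|n IHn]; first by case: i.
rewrite leq_eqVlt => /predU1P[-> //|ltin] /=.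
by rewrite nth_rcons size_sinv_upto ltin IHn.
Qed.

Lemma sinvS f n : sinv f n.+1 =
  - (f 0%N)^-1 * \sum_(k < n.+1) f k.+1 * sinv f (n - k)%N.
Proof.
rewrite /sinv /= nth_rcons size_sinv_upto ltnn eqxx; congr (_ * _).
by apply: eq_bigr => k _; rewrite -/(sinv f _) nth_sinv_upto ?leq_subr.
Qed.

Lemma smul_sinv f n : f 0%N != 0 -> smul f (sinv f) n = (n == 0%N)%:R.
Proof.
move=> f0; rewrite /smul; case: n => [|n].
  by rewrite big_ord_recl big_ord0 addr0 /sinv /= divff.
rewrite big_ord_recl subn0 sinvS mulrA mulrN divff // mulN1r addrC.
by under eq_bigr => k _ do rewrite lift0 subSS; rewrite subrr.
Qed.

Section Truncation.
Variables (A : comUnitRingType) (c : {rmorphism rat -> A}) (x : A) (N : nat).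
Hypothesis xN0 : x ^+ N = 0.

(** Evaluation of a series at the nilpotent [x]. It respects sums, products and shifts, and so
    carries [theta4] into [A], where the product formulas hold. *)
Definition trunc (f : ser) : A := \sum_(k < N) c (f k) * x ^+ k.

Lemma trunc_sadd f g : trunc (sadd f g) = trunc f + trunc g.
Proof.
rewrite /trunc -big_split; apply: eq_bigr => k _.
by rewrite /sadd rmorphD mulrDl.
Qed.

Lemma trunc_sscale a f : trunc (sscale a f) = c a * trunc f.
Proof.
rewrite /trunc mulr_sumr; apply: eq_bigr => k _.
by rewrite /sscale rmorphM mulrA.
Qed.

(** The terms that the shift pushes to exponent [N] or beyond vanish. This serves both [sshift] and
    the Cauchy product. *)
Lemma sum_expr_trunc (h : nat -> A) i :
  \sum_(n < N | (i <= n)%N) h (n - i)%N * x ^+ n = x ^+ i * \sum_(j < N) h j * x ^+ j.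
Proof.
have [leiN|ltNi] := leqP i N; last first.
  rewrite (expr_nilp xN0 (ltnW ltNi)) mul0r big1 // => n lein.
  by have := ltn_ord n; lia.
rewrite -(big_mkord (fun n => i <= n)%N (fun n => h (n - i)%N * x ^+ n)).
rewrite (big_cat_nat (n := i)) //= big_nat_cond big1 ?add0r; last first.
  by move=> n /andP[/andP[_ ltni] lein]; lia.
rewrite big_nat_cond (eq_bigl (fun n => (i <= n < N)%N)); last by move=> n; lia.
rewrite -big_nat -{1}[i]add0n big_addn big_mkord.
rewrite -(subnK leiN) [in RHS]big_split_ord /= mulrDr [X in _ = _ + X]mulr_sumr.
rewrite [X in _ = _ + X]big1 ?addr0; last first.
  move=> j _; rewrite mulrCA -exprD (expr_nilp xN0) ?mulr0 //; lia.
rewrite mulr_sumr addnK; apply: eq_bigr => j _.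
by rewrite addnK exprD; ring.
Qed.

Lemma trunc_sshift k f : trunc (sshift k f) = x ^+ k * trunc f.
Proof.
rewrite -(sum_expr_trunc (fun j => c (f j))) [RHS]big_mkcond.
apply: eq_bigr => n _; rewrite /sshift; case: ifP => // _.
by rewrite rmorph0 mul0r.
Qed.

Lemma trunc_smul f g : trunc (smul f g) = trunc f * trunc g.
Proof.
rewrite [RHS]mulr_suml.
transitivity (\sum_(n < N) \sum_(i < N | (i <= n)%N) c (f i) * (c (g (n - i)%N) * x ^+ n)).
  apply: eq_bigr => n _; rewrite rmorph_sum mulr_suml.
  rewrite (big_ord_widen N (fun i => c (f i * g (n - i)%N) * x ^+ n)) //.
  by apply: eq_bigr => i _; rewrite rmorphM mulrA.
rewrite (exchange_big_dep xpredT) //=; apply: eq_bigr => i _.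
by rewrite -mulr_sumr (sum_expr_trunc (fun j => c (g j))) mulrA.
Qed.

Lemma trunc_sinv f : (0 < N)%N -> f 0%N != 0 -> trunc f * trunc (sinv f) = 1.
Proof.
move=> N_gt0 f0; rewrite -trunc_smul /trunc -(prednK N_gt0) big_ord_recl big1.
  by rewrite smul_sinv // rmorph1 expr0 mulr1 addr0.
by move=> i _; rewrite smul_sinv // rmorph0 mul0r.
Qed.

(** The exponents agree: [m k(k-1)/2 + a k = a tri k + (m - a) tri (-k)]. So do the signs, because
    [tri k + tri (-k) = k^2] has the parity of [k]. *)
Lemma jser_isum s a m n L : (a <= m)%N -> (0 < m)%N -> (n < L)%N ->
  jser s a m n = isum (fun k => ((a * tri k + (m - a) * tri (- k))%N == n)%:R *
                        (if s then 1 else -1) ^+ (tri k + tri (- k))) L.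
Proof.
move=> leam m_gt0 ltnL; rewrite (isum_trunc _ ltnL); last first.
  move=> k ltnk; rewrite (_ : (_ == n) = false) ?mul0r //; apply/eqP.
  move: (triE k) (triN k); move: (tri k) (tri (- k)) => t t' tE t'E.
  have ltnt : (n < t)%N by nia.
  have ltnt' : (n < t')%N by nia.
  nia.
rewrite /jser /isum (_ : (2 * n + 3)%N = n.+1.*2.+1); last by lia.
apply: eq_bigr => j _; move: (j%:Z - n.+1%:Z) => k.
move: (triE k) (triN k); move: (tri k) (tri (- k)) => t t' tE t'E.
have -> : (m%:Z * k * (k - 1) + 2 * a%:Z * k == 2 * n%:Z)
        = ((a * t + (m - a) * t')%N == n).
  have : ((a * t + (m - a) * t')%N%:Z) * 2 = m%:Z * k * (k - 1) + 2 * a%:Z * k.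
    rewrite PoszD !PoszM -subzn // t'E.
    transitivity (m%:Z * (t%:Z * 2 - 2 * k) + 2 * a%:Z * k); first ring.
    by rewrite tE; ring.
  by move=> <-; apply/eqP/eqP; lia.
case: eqP => _; rewrite ?mul0r // mul1r; case: s; first by rewrite expr1n.
rewrite -signr_odd -[RHS]signr_odd; congr (_ ^+ _); congr nat_of_bool.
nia.
Qed.

(** After exchanging the sums each [k] contributes a single monomial, which is zero once its
    exponent reaches [N]. *)
Lemma trunc_jser s a m L : (a <= m)%N -> (0 < m)%N -> (N <= L)%N ->
  trunc (jser s a m) =
  isum (theta_term ((if s then 1 else -1) * x ^+ a)
                   ((if s then 1 else -1) * x ^+ (m - a))) L.
Proof.
move=> leam m_gt0 leNL; rewrite /trunc.
under eq_bigr => n _.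
  rewrite (@jser_isum _ _ _ _ L) // ?(leq_trans _ leNL) // /isum rmorph_sum mulr_suml.
  over.
rewrite exchange_big; apply: eq_bigr => j _; move: (j%:Z - L%:Z) => k /=.
set e := (_ + _)%N; set s1 : rat := if s then 1 else -1.
have -> : theta_term ((if s then 1 else -1) * x ^+ a) ((if s then 1 else -1) * x ^+ (m - a)) k
    = c s1 ^+ (tri k + tri (- k)) * x ^+ e.
  have -> : c s1 = if s then 1 else -1 by rewrite /s1; case: (s); rewrite ?rmorphN rmorph1.
  rewrite /theta_term (exprMn _ _ (x ^+ a)) (exprMn _ _ (x ^+ (m - a))) -!exprM.
  by rewrite [(if _ then _ else _) ^+ (_ + _)]exprD /e [x ^+ (_ + _)]exprD mulrACA.
have [ltN|leN] := ltnP e N.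
  rewrite (bigD1 (Ordinal ltN)) //= eqxx mul1r rmorphXn /= big1 ?addr0 // => n neq.
  rewrite (_ : (e == n) = false) ?mul0r ?rmorph0 ?mul0r //.
  by apply/negP => /eqP en; case/eqP: neq; apply: val_inj.
rewrite (expr_nilp xN0 leN) mulr0 big1 // => n _.
rewrite (_ : (e == n) = false) ?mul0r ?rmorph0 ?mul0r //.
by apply/eqP; have := ltn_ord n; lia.
Qed.
End Truncation.

(** * The q-binomial theorem and the crank generating function *)

Section QBinomialTheorem.
Variables (A : comUnitRingType) (a q : A) (N : nat).
Hypothesis qN0 : q ^+ N = 0.

Let coeff n : A := qpoch a q n / qpoch q q n.
Let F (t : A) : A := \sum_(n < N) coeff n * t ^+ n.

Let coeffS n : coeff n.+1 * (1 - q ^+ n.+1) = coeff n * (1 - a * q ^+ n).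
Proof.
have u1 : 1 - q ^+ n.+1 \is a GRing.unit.
  by apply: (@unitr_1Bnilp _ _ N); rewrite -exprM mulnC exprM qN0 expr0n.
rewrite /coeff !qpochS -exprS invrM ?(qpoch_unit _ _ qN0) //.
transitivity (qpoch a q n * (1 - a * q ^+ n) / qpoch q q n *
              ((1 - q ^+ n.+1)^-1 * (1 - q ^+ n.+1))); first by ring.
by rewrite mulVr // mulr1; ring.
Qed.

Let F_rec t : t ^+ N = 0 -> (1 - t) * F t = (1 - a * t) * F (t * q).
Proof.
move=> tN0; suff e : F t - F (t * q) = t * F t - a * t * F (t * q).
  have -> : (1 - t) * F t = F t - F (t * q) - t * F t + F (t * q) by ring.
  by rewrite e; ring.
have -> : F t - F (t * q) = \sum_(n < N) coeff n * (1 - q ^+ n) * t ^+ n.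
  rewrite /F -sumrB; apply: eq_bigr => n _; rewrite exprMn; ring.
have -> : t * F t - a * t * F (t * q) =
          \sum_(n < N) coeff n * (1 - a * q ^+ n) * t ^+ n.+1.
  rewrite /F !mulr_sumr -sumrB; apply: eq_bigr => n _; rewrite exprMn exprS; ring.
case: N tN0 => [|N' tN0]; first by rewrite !big_ord0.
(* The left sum loses its term [n = 0], the right one its top term with [t^N = 0]; [coeffS] matches
   the rest. *)
rewrite big_ord_recl expr0 subrr mulr0 mul0r add0r big_ord_recr /= tN0 mulr0 addr0.
by apply: eq_bigr => n _; rewrite /bump leq0n add1n coeffS.
Qed.

(** Iterating the functional equation [F_rec] [N] times moves the argument to [t q^N = 0], where the
    series is 1. *)
Lemma q_binomial_nilp t : t ^+ N = 0 ->
  \sum_(n < N) qpoch a q n / qpoch q q n * t ^+ n = qpoch (a * t) q N / qpoch t q N.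
Proof.
move=> tN0; rewrite -/(F t); apply: (mulIr (qpoch_unit q N tN0)).
rewrite mulrVK ?(qpoch_unit _ _ tN0) //.
have tqN0 k : (t * q ^+ k) ^+ N = 0 by rewrite exprMn tN0 mul0r.
have iter k : F t * qpoch t q k = qpoch (a * t) q k * F (t * q ^+ k).
  elim: k => [|k IHk]; first by rewrite /qpoch !big_ord0 expr0 !mulr1 mul1r.
  rewrite !qpochS mulrA IHk -[RHS]mulrA -[LHS]mulrA; congr (_ * _).
  by rewrite mulrC F_rec // -(mulrA t) -exprSr mulrA.
rewrite iter qN0 mulr0; suff -> : F 0 = 1 by rewrite mulr1.
rewrite /F; case: N tN0 => [|N' _].
  by rewrite expr0 => /eqP; rewrite oner_eq0.
rewrite big_ord_recl big1 ?addr0.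
  by rewrite /coeff /qpoch !big_ord0 expr0 mulr1 divr1.
by move=> i _; rewrite lift0 expr0n mulr0.
Qed.
End QBinomialTheorem.

Lemma prod_ord_nat {A : comPzSemiRingType} (f : nat -> A) N a b : (b <= N)%N ->
  \prod_(i < N | (a <= i < b)%N) f i = \prod_(a <= i < b) f i.
Proof.
move=> lebN; rewrite -(big_mkord (fun i => a <= i < b)%N).
by rewrite [RHS](big_nat_widenl a 0) // [RHS](big_nat_widen _ _ N) //.
Qed.

Section CrankIdentity.
Variables (A : comUnitRingType) (x z : A) (N : nat).
Hypotheses (xN0 : x ^+ N = 0) (zu : z \is a GRing.unit) (N_gt1 : (1 < N)%N).

(** This is [G(z)]: the omitted factors are 1 because [x^N = 0]. *)
Definition crank_gf : A := qpoch x x N / (qpoch (z * x) x N * qpoch (x / z) x N).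

Let zx0 : (z * x) ^+ N = 0. Proof. by rewrite exprMn xN0 mulr0. Qed.
Let xz0 : (x / z) ^+ N = 0. Proof. by rewrite exprMn xN0 mul0r. Qed.
Let u1 i : (0 < i)%N -> 1 - x ^+ i \is a GRing.unit.
Proof.
by move=> i_gt0; apply: (@unitr_1Bnilp _ _ N); rewrite -exprM (expr_nilp xN0) // leq_pmull.
Qed.
Let uz i : (0 < i)%N -> 1 - z * x ^+ i \is a GRing.unit.
Proof.
move=> i_gt0; apply: (@unitr_1Bnilp _ _ N).
by rewrite exprMn -exprM (expr_nilp xN0) ?mulr0 // leq_pmull.
Qed.

Lemma prod_parts_le m : (0 < m < N)%N ->
  \prod_(i < N | (1 < i <= m)%N) (1 - x ^+ i)^-1 = (1 - x) / qpoch x x m.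
Proof.
case/andP=> m_gt0 ltmN.
rewrite (@prod_ord_nat _ (fun i => (1 - x ^+ i)^-1) N 2 m.+1) // big_add1 /=.
rewrite /qpoch -(big_mkord xpredT (fun i => 1 - x * x ^+ i)) [\prod_(0 <= i < m) _]big_ltn // expr0 mulr1.
under [in RHS]eq_bigr => i _ do rewrite -exprS.
have pu : \prod_(1 <= i < m) (1 - x ^+ i.+1) \is a GRing.unit.
  by elim/big_rec: _ => [|i y _ yu]; rewrite ?unitr1 // unitrM u1.
rewrite invrM ?(u1 (ltn0Sn 0)) // mulrCA mulrV ?(u1 (ltn0Sn 0)) // mulr1.
apply: (mulIr pu); rewrite mulVr // -big_split big1 //= => i _.
by rewrite mulVr // u1.
Qed.

Lemma prod_parts_gt m : (m < N)%N ->
  \prod_(i < N | (m < i)%N) (1 - z * x ^+ i)^-1 =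
  qpoch (z * x) x m / qpoch (z * x) x N.
Proof.
move=> ltmN; rewrite (eq_bigl (fun i : 'I_N => (m.+1 <= i < N)%N)); last first.
  by move=> i; rewrite ltn_ord andbT.
rewrite (@prod_ord_nat _ (fun i => (1 - z * x ^+ i)^-1) N m.+1 N) // big_add1.
apply: (mulIr (qpoch_unit x N zx0)); rewrite mulrVK ?(qpoch_unit _ _ zx0) //.
(* The last factor is [1 - z x^N = 1], so the parts stop at [N - 1], as on the left. *)
have -> : qpoch (z * x) x N = qpoch (z * x) x N.-1.
  by rewrite -{1}(prednK (ltnW N_gt1)) qpochS -mulrA -exprS prednK ?(ltnW N_gt1) //
     xN0 mulr0 subr0 mulr1.
rewrite /qpoch -!(big_mkord xpredT (fun i => 1 - z * x * x ^+ i)).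
rewrite [\prod_(0 <= i < N.-1) _](big_cat_nat (n := m)) //=; last by lia.
rewrite mulrCA -big_split [X in _ * X]big1 ?mulr1 //= => i _.
by rewrite -mulrA -exprS mulVr ?uz.
Qed.

(** The first sum runs over the largest part [m] of a partition without ones, the second over the
    number [m] of ones. The correction [x - z x] sits in degree 1: the partition of 1 has crank -1
    and yields [z^-1 x], while [G(z)] has [(z + z^-1 - 1) x]. *)
Lemma crank_identity :
  \sum_(m < N | m != 1%N :> nat) (if m == 0%N :> nat then 1 else
     (z * x) ^+ m * \prod_(i < N | (1 < i <= m)%N) (1 - x ^+ i)^-1) +
  \sum_(m < N | (0 < m)%N) (x / z) ^+ m *
     ((\prod_(i < N | (1 < i <= m)%N) (1 - x ^+ i)^-1) *
      (\prod_(i < N | (m < i)%N) (1 - z * x ^+ i)^-1))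
  = crank_gf + x - z * x.
Proof.
have N_gt0 := ltnW N_gt1; pose i0 := Ordinal N_gt0; pose i1 := Ordinal N_gt1.
have p0 (b : A) : qpoch b x 0 = 1 by rewrite /qpoch big_ord0.
have euler : \sum_(m < N) (1 - x) * ((z * x) ^+ m / qpoch x x m)
           = (1 - x) / qpoch (z * x) x N.
  rewrite -mulr_sumr; congr (_ * _).
  have := q_binomial_nilp 0 xN0 zx0; rewrite mul0r.
  have q0 n : qpoch 0 x n = 1 by apply: big1 => i _; rewrite mul0r subr0.
  rewrite q0 mul1r => <-; apply: eq_bigr => m _.
  by rewrite q0 mul1r mulrC.
have cauchy : \sum_(m < N) (1 - x) * ((x / z) ^+ m / qpoch x x m *
                (qpoch (z * x) x m / qpoch (z * x) x N)) = crank_gf.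
  have := q_binomial_nilp (z * x) xN0 xz0.
  have -> : z * x * (x / z) = x * x by rewrite mulrACA [z * x]mulrC mulrACA mulrV // mulr1.
  move=> E; transitivity ((1 - x) * (qpoch (x * x) x N / qpoch (x / z) x N)
                           / qpoch (z * x) x N).
    rewrite -E mulr_sumr mulr_suml; apply: eq_bigr => m _; ring.
  (* The factor [1 - x] completes [qpoch (x * x) x N] to [qpoch x x N.+1], whose last factor is
     1. *)
  rewrite mulrA -qpoch_recl (qpoch_trunc _ xN0 (leqnSn N)) /crank_gf.
  by rewrite invrM ?(qpoch_unit _ _ zx0) ?(qpoch_unit _ _ xz0) // mulrA.
have small : \sum_(m < N | m != 1%N :> nat) (if m == 0%N :> nat then 1 else
     (z * x) ^+ m * \prod_(i < N | (1 < i <= m)%N) (1 - x ^+ i)^-1)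
   = (1 - x) / qpoch (z * x) x N + x - z * x.
  (* Against Euler's sum, the term [m = 0] is 1 instead of [1 - x], and the term [m = 1], equal to
     [z x], is absent. *)
  rewrite -euler (bigD1 i0) //= [in RHS](bigD1 i0) //= [in RHS](bigD1 i1) //=.
  rewrite expr0 p0 divr1 expr1 qpochS p0 expr0 mulr1 mul1r.
  rewrite [(1 - x) * (z * x / _)]mulrC mulrVK ?(u1 (ltn0Sn 0)) //.
  set R := \sum_(m < N | (m != i0) && (m != i1)) _.
  rewrite (_ : \sum_(m < N | _) _ = R); first by ring.
  apply: eq_big => [m|m /andP[m1 m0]]; first by rewrite andbC.
  rewrite (negbTE (m0 : m != 0%N :> nat)) prod_parts_le; first by ring.
  by rewrite ltn_ord lt0n (m0 : m != 0%N :> nat).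
(* The term [m = 0] of Cauchy's sum is [(1 - x) / qpoch (z * x) x N], which the first sum
   supplies. *)
rewrite small -cauchy [in RHS](bigD1 i0) //= !p0 expr0 divr1 !mul1r.
rewrite (eq_bigr (fun m : 'I_N => (1 - x) * ((x / z) ^+ m / qpoch x x m *
                (qpoch (z * x) x m / qpoch (z * x) x N)))); last first.
  by move=> m m_gt0; rewrite prod_parts_le ?m_gt0 ?ltn_ord // prod_parts_gt //; ring.
rewrite (eq_bigl (fun m : 'I_N => m != i0)); first by ring.
by move=> m; rewrite lt0n.
Qed.
End CrankIdentity.

(** * Counting partitions by crank *)

Section Multiplicities.
Variable n : nat.
Hypothesis n_gt0 : (0 < n)%N.
Implicit Type mu : {ffun 'I_n.+1 -> 'I_n.+1}.

Let i1 : 'I_n.+1 := Ordinal (n_gt0 : (1 < n.+1)%N).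

Lemma nonesE mu : nones mu = mu i1.
Proof. by rewrite /nones (big_pred1 i1). Qed.

Lemma lpart_lt mu : (lpart mu < n.+1)%N.
Proof. by rewrite ltnS; apply/bigmax_leqP => i _; rewrite -ltnS. Qed.

Lemma lpart_max mu (i : 'I_n.+1) : (lpart mu < i)%N -> mu i = 0%N :> nat.
Proof.
apply: contraTeq; rewrite -lt0n -leqNgt => mui.
exact: (@leq_bigmax_cond _ (fun i => 0 < mu i)%N (fun i => i : nat)).
Qed.

Lemma lpart_gt0 mu : (0 < lpart mu)%N -> (0 < mu (inord (lpart mu)))%N.
Proof.
move=> l_gt0; have : (0 < #|[pred i | (0 < mu i)%N]|)%N.
  rewrite lt0n; apply: contraTneq l_gt0 => /card0_eq none.
  rewrite -leqNgt; apply/bigmax_leqP => i mui.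
  by have := none i; rewrite !inE mui.
by case/(eq_bigmax_cond (fun i : 'I_n.+1 => i : nat)) => i mui; rewrite /lpart => ->; rewrite inord_val.
Qed.
End Multiplicities.

Section CrankSum.
Variables (A : comUnitRingType) (x z : A) (n : nat).
Hypotheses (xn0 : x ^+ n.+1 = 0) (zu : z \is a GRing.unit) (n_gt0 : (0 < n)%N).
Implicit Type mu : {ffun 'I_n.+1 -> 'I_n.+1}.

(* [low m i j] is the weight of [j] copies of the part [i] among the partitions
   without ones and with largest part [m]; [high m i j] is the same for the
   partitions with exactly [m > 0] ones. *)
Let low (m i j : nat) : A :=
  if (1 < i < m)%N then x ^+ (i * j)
  else if (i == m) && (0 < m)%N then (j != 0%N)%:R * z ^+ m * x ^+ (i * j)
  else (j == 0%N)%:R.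
Let high (m i j : nat) : A :=
  if i == 0%N then (j == 0%N)%:R
  else if i == 1%N then (j == m)%:R * z ^- m * x ^+ (i * j)
  else (if (m < i)%N then z ^+ j else 1) * x ^+ (i * j).

Let i1 : 'I_n.+1 := Ordinal (n_gt0 : (1 < n.+1)%N).

Let prod0 (f : nat -> nat -> A) mu (i : 'I_n.+1) :
  f i (mu i) = 0 -> \prod_(k < n.+1) f k (mu k) = 0.
Proof. by move=> fi; rewrite (bigD1 i) //= fi mul0r. Qed.

(** Only [m = lpart mu] survives: a smaller [m] forbids the largest part, a larger one demands a
    part [m] that does not occur. *)
Lemma low_sum mu : mu ord0 = 0%N :> nat -> nones mu = 0%N ->
  \sum_(m < n.+1 | m != 1%N :> nat) \prod_(i < n.+1) low m i (mu i)
  = z ^ crank mu * x ^+ (\sum_(i < n.+1) i * mu i).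
Proof.
move=> mu0 mu1; rewrite /crank mu1 eqxx.
have mu1' : mu i1 = 0%N :> nat by rewrite -(nonesE n_gt0).
have vL : (inord (lpart mu) : 'I_n.+1) = lpart mu :> nat by apply: inordK; apply: lpart_lt.
have L1 : lpart mu != 1%N.
  apply/eqP => L1; have := @lpart_gt0 _ mu; rewrite L1 => /(_ isT).
  by rewrite (_ : inord 1 = i1) ?mu1' //; apply: val_inj; rewrite /= inordK.
rewrite (bigD1 (inord (lpart mu))) ?vL //= [X in _ + X]big1 ?addr0; last first.
  move=> m /andP[m1 mL]; have {}mL : m != lpart mu :> nat.
    by apply: contra mL => /eqP mL; rewrite -val_eqE /= vL mL.
  have [ltmL|] := ltnP m (lpart mu).
    apply: (@prod0 (low m) mu (inord (lpart mu))); rewrite /low vL.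
    rewrite [(1 < _ < _)%N](_ : _ = false) 1?eq_sym ?(negbTE mL) /=; last by lia.
    by rewrite eqn0Ngt lpart_gt0 //; lia.
  rewrite leq_eqVlt eq_sym (negbTE mL) /= => ltLm.
  apply: (@prod0 (low m) mu m); rewrite /low ltnn andbF eqxx (leq_trans _ ltLm) //=.
  by rewrite (lpart_max ltLm) mul0r mul0r.
have zL : z ^+ lpart mu = \prod_(i < n.+1)
    if (i == lpart mu :> nat) && (0 < lpart mu)%N then z ^+ lpart mu else 1.
  rewrite (bigD1 (inord (lpart mu))) //= vL eqxx /= big1 ?mulr1.
    by case: (posnP (lpart mu)) => [->|].
  move=> i iL; rewrite (_ : (_ == _) = false) //; apply: contraNF iL => /eqP iL.
  by rewrite -val_eqE /= vL iL.
rewrite -exprnP zL -prodrXr -big_split; apply: eq_bigr => i _ /=.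
rewrite /low; case: ifP => [/andP[i_gt1 iL]|i_out].
  by rewrite (ltn_eqF iL) mul1r.
case: ifP => [/andP[/eqP iL L_gt0]|iL].
  have -> : (mu i != 0%N :> nat) = true.
    have := lpart_gt0 L_gt0; rewrite lt0n (_ : inord _ = i) //.
    by apply: val_inj; rewrite /= vL.
  by rewrite mul1r.
suff -> : mu i = 0%N :> nat by rewrite muln0 mulr1.
have [->//|i_gt0] := eqVneq i ord0.
have [->//|i_gt1] := eqVneq i i1.
apply: lpart_max; move: i_gt0 i_gt1 i_out iL; rewrite -!val_eqE /=; lia.
Qed.

Lemma high_sum mu : mu ord0 = 0%N :> nat -> (0 < nones mu)%N ->
  \sum_(m < n.+1 | (0 < m)%N) \prod_(i < n.+1) high m i (mu i)
  = z ^ crank mu * x ^+ (\sum_(i < n.+1) i * mu i).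
Proof.
move=> mu0 mu1_gt0; rewrite /crank (gtn_eqF mu1_gt0).
move: mu1_gt0; rewrite (nonesE n_gt0) => mu1_gt0.
rewrite (bigD1 (mu i1)) //= [X in _ + X]big1 ?addr0; last first.
  move=> m /andP[m_gt0 m1]; apply: (@prod0 (high m) mu i1).
  rewrite /high /= (_ : (mu i1 == m :> nat) = false) ?mul0r //.
  by apply: contraNF m1 => /eqP e; rewrite -val_eqE /= e.
rewrite exprzDr // -exprnN -exprnP -prodrXr.
have -> : z ^+ nbig mu * z ^- mu i1 = \prod_(i < n.+1)
    ((if (mu i1 < i)%N then z ^+ mu i else 1) * (if i == i1 then z ^- mu i1 else 1)).
  rewrite big_split /= -!big_mkcond /= big_pred1_eq /nbig (nonesE n_gt0).
  by rewrite prodrXr.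
rewrite -big_split; apply: eq_bigr => i _ /=; rewrite /high.
case: ifP => [/eqP i0|i0].
  have -> : i = ord0 by apply: val_inj.
  by rewrite mu0 muln0 /= !mulr1.
case: ifP => [/eqP e1|e1].
  have -> : i = i1 by apply: val_inj.
  by rewrite !eqxx !mul1r ltnNge mu1_gt0 mul1r.
by rewrite (_ : (i == i1) = false) ?mulr1 // -val_eqE.
Qed.

(** A part 1 kills every [low] product in the sum, its absence kills every [high] product, and a
    part 0 kills both. *)
Lemma low_high_sum mu :
  \sum_(m < n.+1 | m != 1%N :> nat) \prod_(i < n.+1) low m i (mu i) +
  \sum_(m < n.+1 | (0 < m)%N) \prod_(i < n.+1) high m i (mu i)
  = if mu ord0 == 0%N :> nat then z ^ crank mu * x ^+ (\sum_(i < n.+1) i * mu i) else 0.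
Proof.
case: eqP => [mu0|/eqP mu0]; last first.
  rewrite !big1 ?addr0 // => m m_in.
    by apply: (@prod0 (high m) mu ord0); rewrite /high (negbTE mu0).
  apply: (@prod0 (low m) mu ord0); rewrite /low /= (negbTE mu0).
  by case: ifP => // /andP[/eqP <-].
have [mu1|mu1_gt0] := posnP (nones mu).
  rewrite low_sum // [X in _ + X]big1 ?addr0 // => m m_gt0.
  apply: (@prod0 (high m) mu i1); rewrite /high /= -(nonesE n_gt0) mu1.
  by rewrite eq_sym (gtn_eqF m_gt0) !mul0r.
rewrite high_sum // big1 ?add0r // => m m1.
apply: (@prod0 (low m) mu i1); rewrite /low /= (eq_sym 1%N) (negbTE m1) /=.
by rewrite -(nonesE n_gt0) (gtn_eqF mu1_gt0).
Qed.

Let geom (y : A) : y ^+ n.+1 = 0 -> \sum_(j < n.+1) y ^+ j = (1 - y)^-1.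
Proof. exact: geom_nilp. Qed.

Let xi0 i : (0 < i)%N -> (x ^+ i) ^+ n.+1 = 0.
Proof. by move=> i_gt0; rewrite -exprM (expr_nilp xn0) // leq_pmull. Qed.

Let delta (f : nat -> A) (k : 'I_n.+1) :
  \sum_(j < n.+1) (j == k :> nat)%:R * f j = f k.
Proof.
rewrite (bigD1 k) //= eqxx mul1r big1 ?addr0 // => j jk.
by rewrite -val_eqE /= in jk; rewrite (negbTE jk) mul0r.
Qed.

Let delta0 : \sum_(j < n.+1) (j == 0%N :> nat)%:R = 1 :> A.
Proof.
by have := delta (fun _ => 1) ord0; under eq_bigr => j _ do rewrite mulr1.
Qed.

Lemma low_prod (m : 'I_n.+1) : m != 1%N :> nat ->
  \prod_(i < n.+1) \sum_(j < n.+1) low m i j =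
  if m == 0%N :> nat then 1 else
    (z * x) ^+ m * \prod_(i < n.+1 | (1 < i <= m)%N) (1 - x ^+ i)^-1.
Proof.
move=> m1; case: ifP => [/eqP m0|/negbT m0].
  apply: big1 => i _; rewrite -[RHS]delta0; apply: eq_bigr => j _.
  by rewrite /low m0 ltn0 andbF andbF.
have m_gt1 : (1 < m)%N by case: (nat_of_ord m) m0 m1 => [|[]].
have -> : (z * x) ^+ m = \prod_(i < n.+1) (if i == m then (z * x) ^+ m else 1).
  by rewrite -big_mkcond big_pred1_eq.
rewrite [X in _ * X]big_mkcond -big_split; apply: eq_bigr => i _ /=.
have [->|im] := eqVneq i m.
  rewrite m_gt1 leqnn /=.
  have := geom (xi0 (ltnW m_gt1)); rewrite big_ord_recl expr0 => E.
  rewrite big_ord_recl /low ltnn andbF eqxx (ltnW m_gt1) /= mul0r mul0r add0r.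
  (* The largest part must occur, so its geometric series lacks the constant term; [z^m] is charged
     once. *)
  have -> : \sum_(j < n) (lift ord0 j != 0%N :> nat)%:R * z ^+ m * x ^+ (m * lift ord0 j)
     = z ^+ m * ((1 - x ^+ m)^-1 - 1).
    rewrite -E addrAC subrr add0r mulr_sumr; apply: eq_bigr => j _.
    by rewrite lift0 mul1r exprM.
  have u : 1 - x ^+ m \is a GRing.unit := unitr_1Bnilp (xi0 (ltnW m_gt1)).
  by apply: (mulIr u); rewrite mulrVK // -mulrA mulrBl mulVr // exprMn; ring.
have im' : (i == m :> nat) = false by rewrite val_eqE; apply: negbTE.
rewrite mul1r [(i <= m)%N]leq_eqVlt im' /=; case: ifP => im2.
  rewrite -geom ?xi0 //; last by lia.
  by apply: eq_bigr => j _; rewrite /low im2 exprM.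
by rewrite -[RHS]delta0; apply: eq_bigr => j _; rewrite /low im2 im'.
Qed.

Lemma high_prod (m : 'I_n.+1) : (0 < m)%N ->
  \prod_(i < n.+1) \sum_(j < n.+1) high m i j =
  (x / z) ^+ m * ((\prod_(i < n.+1 | (1 < i <= m)%N) (1 - x ^+ i)^-1) *
                  (\prod_(i < n.+1 | (m < i)%N) (1 - z * x ^+ i)^-1)).
Proof.
move=> m_gt0.
have -> : (x / z) ^+ m = \prod_(i < n.+1) (if i == i1 then (x / z) ^+ m else 1).
  by rewrite -big_mkcond big_pred1_eq.
rewrite [\prod_(i < _ | (1 < _ <= _)%N) _]big_mkcond [\prod_(i < _ | (_ < _)%N) _]big_mkcond.
rewrite -!big_split; apply: eq_bigr => i _ /=.
have [i0|i_gt0] := posnP i.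
  have -> : (i == i1) = false by rewrite -val_eqE /= i0.
  rewrite i0 ltn0 /= !mulr1 -[RHS]delta0; apply: eq_bigr => j _.
  by rewrite /high.
have [->|ne1] := eqVneq i i1.
  rewrite ltnn /= ltnNge m_gt0 /= !mulr1.
  rewrite -[X in X = _]/(\sum_(j < n.+1) (j == m :> nat)%:R * z ^- m * x ^+ (1 * j)).
  under eq_bigr => j _ do rewrite -mulrA.
  by rewrite (delta (fun j => z ^- m * x ^+ (1 * j))) mul1n exprMn exprVn mulrC.
have ne1' : (i == 1%N :> nat) = false by rewrite -[1%N]/(val i1) val_eqE; apply: negbTE.
rewrite mul1r; have -> : (1 < i)%N by rewrite ltn_neqAle eq_sym ne1'.
rewrite /high (gtn_eqF i_gt0) ne1'; case: ltnP => [ltmi|leim] /=.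
  rewrite mul1r -geom; last by rewrite exprMn xi0 ?mulr0.
  by apply: eq_bigr => j _; rewrite exprMn exprM.
rewrite mulr1 -geom ?xi0 //; apply: eq_bigr => j _.
by rewrite mul1r exprM.
Qed.

(** Distributing the product over the multiplicities turns [crank_identity] into a sum over all
    [mu]. The size is left free, and bounding multiplicities by [n] costs nothing since
    [x^(n+1) = 0]. *)
Lemma crank_sum :
  \sum_(mu : {ffun 'I_n.+1 -> 'I_n.+1} | mu ord0 == 0%N :> nat)
     z ^ crank mu * x ^+ (\sum_(i < n.+1) i * mu i)
  = crank_gf x z n.+1 + x - z * x.
Proof.
rewrite -crank_identity // big_mkcond.
under eq_bigr => mu _ do rewrite -low_high_sum.
rewrite big_split /=; congr (_ + _); rewrite exchange_big; apply: eq_bigr => m m_in.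
  by rewrite -low_prod // (bigA_distr_bigA (fun i j : 'I_n.+1 => low m i j)).
by rewrite -high_prod // (bigA_distr_bigA (fun i j : 'I_n.+1 => high m i j)).
Qed.
End CrankSum.

(** * The theta combinations *)

Section ThetaQuotients.
Variables (A : comUnitRingType) (c : {rmorphism rat -> A}) (x I : A) (N : nat).
Hypotheses (xN0 : x ^+ N = 0) (N_gt0 : (0 < N)%N) (II : I * I = -1).
Local Notation P := (nprod x N).
Local Notation O := (P (- 1) 2 1).
Local Notation Op := (P 1 2 1).
Local Notation J m := (P (- 1) m m).

Let qpochE (s : A) : qpoch (s * x) x N = P (- s) 1 1.
Proof.
by apply: eq_bigr => i _; rewrite mul1n addn1 exprS mulNr mulrA.
Qed.

Let qpoch1E : qpoch x x N = J 1.
Proof. by rewrite -qpochE mul1r. Qed.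

(** Euler's odd-distinct identity [P 1 1 1 * O = 1] clears the denominator. *)
Lemma crank_gf_N1 : crank_gf x (- 1) N = O * O * O * J 2.
Proof.
have J2u : J 2 \is a GRing.unit by apply: nprod_unit.
have P1 : P 1 1 1 * O = 1.
  apply: (mulIr J2u); rewrite mul1r -mulrA -nprod_J1 //; exact: nprod_distinct1.
have P1u : P 1 1 1 \is a GRing.unit by apply: nprod_unit.
rewrite /crank_gf invrN1 mulrN1 -[- x]mulN1r qpochE opprK.
rewrite qpoch1E nprod_J1 //.
apply: (mulIr P1u); apply: (mulIr P1u); rewrite -2![LHS]mulrA mulVr ?unitrM ?P1u //.
transitivity (O * J 2 * (P 1 1 1 * O) * (P 1 1 1 * O)); last by ring.
by rewrite P1 !mulr1.
Qed.

(** The factors [1 - I x^i] and [1 + I x^i] pair to [1 + x^(2i)]; Euler's identity in [x^2] then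
    inverts the product as [O * Op]. *)
Lemma crank_gf_I : crank_gf x I N = O * O * Op * J 2.
Proof.
have J2u : J 2 \is a GRing.unit by apply: nprod_unit.
have J4u : J 4 \is a GRing.unit by apply: nprod_unit.
have Pu : P 1 2 2 \is a GRing.unit by apply: nprod_unit.
have PO : P 1 2 2 * (O * Op) = 1.
  apply: (mulIr J4u); rewrite mul1r -mulrA -nprod_J2 //; exact: nprod_distinct2.
have Iinv : I^-1 = - I.
  have Iu : I \is a GRing.unit by apply/unitrPr; exists (- I); rewrite mulrN II opprK.
  by apply: (mulrI Iu); rewrite mulrV // mulrN II opprK.
rewrite /crank_gf Iinv [x * _]mulrC !qpochE opprK mulrC [P (- I) 1 1 * _]mulrC.
rewrite nprod_mulN II opprK qpoch1E nprod_J1 //.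
apply: (mulrI Pu); rewrite mulrA mulrV // mul1r.
transitivity (P 1 2 2 * (O * Op) * (O * J 2)); last by ring.
by rewrite PO mul1r.
Qed.

(** The [X]'s are the four theta products over [J 4]. Their signs come from expanding
    [(E - x F) (G + s x H)] for [s = -1] and [s = 1]. *)
Lemma trunc_theta4 a0 a1 a2 a3 :
  let B := crank_gf x (- 1) N in let C := crank_gf x I N in
  exists X0 X1 X2 X3 : A,
  [/\ trunc c x N (theta4 a0 a1 a2 a3) =
        c (1 / 4) * (c a0 * X0 + c a1 * X1 + c a2 * X2 + c a3 * X3),
      B = X0 + X1 - X2 - X3 & C = X0 - X1 + X2 - X3].
Proof.
move=> B C; set L := (N.*2.+2); set D := trunc c x N (sinv (Jm 4)).
set E := trunc c x N (Jbar 4 8); set F := trunc c x N (Jbar 0 8).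
set G := trunc c x N (Jbar 6 16); set H := trunc c x N (Jbar 14 16).
have leL : (N.*2 <= L)%N by rewrite /L; lia.
have leL' : (N <= L)%N by rewrite /L; lia.
have J0 : Jm 4 0%N != 0.
  by rewrite /Jm /Jam /jser !big_ord_recl big_ord0.
have DJ : D * J 4 = 1.
  rewrite -(@theta_pentagonal _ _ _ xN0 L) // mulrC.
  rewrite -[RHS](@trunc_sinv _ c _ _ xN0 (Jm 4) N_gt0 J0).
  by rewrite /D /Jm /Jam (@trunc_jser _ c _ _ xN0 false 4 12 L).
have EF : E - x * F = O * O * J 2.
  rewrite -(theta_phi_split xN0 leL) /E /F /Jbar.
  rewrite (@trunc_jser _ c _ _ xN0 true 4 8 L) // (@trunc_jser _ c _ _ xN0 true 0 8 L) //.
  by rewrite !mul1r.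
have GH s : s * s = 1 -> G + s * x * H = P s 2 1 * J 4.
  move=> ss; rewrite -(theta_psi_split xN0 ss (leqnn L)) /G /H /Jbar.
  rewrite (@trunc_jser _ c _ _ xN0 true 6 16 L) // (@trunc_jser _ c _ _ xN0 true 14 16 L) //.
  by rewrite !mul1r.
exists (D * (E * G)), (D * (x ^+ 2 * (F * H))), (D * (x * (E * H))), (D * (x * (F * G))).
split.
- rewrite /theta4 trunc_sscale trunc_smul // !trunc_sadd !trunc_sscale !trunc_sshift //.
  by rewrite !trunc_smul // -/D -/E -/F -/G -/H expr1; ring.
- rewrite /B crank_gf_N1.
  transitivity (D * ((E - x * F) * (G + - 1 * x * H))); last by ring.
  rewrite EF GH ?mulrNN ?mulr1 //.
  by transitivity (O * O * O * J 2 * (D * J 4)); [rewrite DJ mulr1 | ring].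
- rewrite /C crank_gf_I.
  transitivity (D * ((E - x * F) * (G + 1 * x * H))); last by ring.
  rewrite EF GH ?mulr1 //.
  by transitivity (O * O * Op * J 2 * (D * J 4)); [rewrite DJ mulr1 | ring].
Qed.
End ThetaQuotients.

(** * Coefficients and the filter modulo 4 *)

Lemma ptn0 (mu : {ffun 'I_1 -> 'I_1}) : is_ptn mu.
Proof. by rewrite /is_ptn big_ord_recl big_ord0 !ord1. Qed.

Lemma npart0 : npart 0 = 1%N.
Proof.
rewrite /npart (_ : [set mu | is_ptn mu] = setT) ?cardsT ?card_ffun ?card_ord //.
by apply/setP => mu; rewrite !inE ptn0.
Qed.

Lemma ptn1 : [set mu : {ffun 'I_2 -> 'I_2} | is_ptn mu] = [set [ffun i => i]].
Proof.
apply/setP => mu; rewrite !inE /is_ptn !big_ord_recl big_ord0 /= mul0n mul1n add0n addn0.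
apply/andP/eqP => [[/eqP m0 /eqP m1]|->]; last by rewrite !ffunE.
apply/ffunP => i; rewrite ffunE; apply: val_inj.
by case: (unliftP ord0 i) => [j ->|->]; [rewrite (ord1 j) | ].
Qed.

Lemma npart1 : npart 1 = 1%N.
Proof. by rewrite /npart ptn1 cards1. Qed.

Lemma crank1 : crank ([ffun i => i] : {ffun 'I_2 -> 'I_2}) = -1.
Proof.
have n1 : nones ([ffun i => i] : {ffun 'I_2 -> 'I_2}) = 1%N.
  by rewrite (nonesE (ltn0Sn 0)) ffunE.
by rewrite /crank /nbig n1 big_pred0 // => i; apply/negbTE; rewrite -leqNgt -ltnS.
Qed.

(** The coefficient of [q^n] in [G(w)], with the exceptional value at [n = 1]. *)
Definition crank_coef (n : nat) (w : algC) : algC :=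
  match n with
  | 0 => 1
  | 1 => w + w^-1 - 1
  | _ => \sum_(mu : {ffun 'I_n.+1 -> 'I_n.+1} | is_ptn mu) w ^ crank mu
  end.

Lemma crank_coefE n w : (0 < n)%N -> crank_coef n w =
  \sum_(mu : {ffun 'I_n.+1 -> 'I_n.+1} | is_ptn mu) w ^ crank mu + (w - 1) * (1%N == n)%:R.
Proof.
case: n => [|[|n]] // _; last by rewrite mulr0 addr0.
rewrite (eq_bigl (fun mu => mu == [ffun i => i])) => [|mu].
  by rewrite big_pred1_eq crank1 exprN1 eqxx /=; ring.
by have /setP/(_ mu) := ptn1; rewrite !inE.
Qed.

Section CoefficientExtraction.
Variables (n : nat) (A : comUnitRingType) (x : A) (cst : {rmorphism algC -> A}).
Variable lc : A -> algC.
Hypotheses (xn0 : x ^+ n.+1 = 0) (lcD : {morph lc : p q / p + q})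
  (lcZ : forall w p, lc (cst w * p) = w * lc p)
  (lcX : forall k, lc (x ^+ k) = (k == n)%:R).

Let lc_sum (J : finType) (Q : pred J) (F : J -> A) :
  lc (\sum_(j | Q j) F j) = \sum_(j | Q j) lc (F j).
Proof.
apply: (big_morph lc lcD).
by have := lcZ 0 0; rewrite mulr0 mul0r.
Qed.

Let lc_trunc f : lc (trunc (cst \o (ratr : rat -> algC)) x n.+1 f) = ratr (f n).
Proof.
rewrite lc_sum big_ord_recr big1 /= ?add0r.
  by rewrite lcZ lcX eqxx mulr1.
by move=> k _; rewrite lcZ lcX (ltn_eqF (ltn_ord k)) mulr0.
Qed.

Let lc_crank_gf w : w != 0 -> lc (crank_gf x (cst w) n.+1) = crank_coef n w.
Proof.
move=> w0; have wu : cst w \is a GRing.unit by rewrite rmorph_unit // unitfE.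
have [n0|n_gt0] := posnP n.
  (* [crank_sum] needs [n > 0]; for [n = 0] the variable itself is zero and [G] is 1. *)
  have x0 : x = 0 by rewrite -[x]expr1 (expr_nilp xn0) // n0.
  rewrite x0 /crank_gf mulr0 mul0r (_ : qpoch 0 0 _ = 1); last first.
    by apply: big1 => i _; rewrite mul0r subr0.
  have -> : crank_coef n w = 1 by rewrite n0.
  by rewrite mulr1 divr1 -[1](expr0 x) lcX n0.
rewrite (crank_coefE _ n_gt0) (_ : crank_gf _ _ _ = (crank_gf x (cst w) n.+1
  + x - cst w * x) + cst (w - 1) * x); last first.
  by rewrite rmorphB rmorph1; ring.
rewrite -(crank_sum xn0 wu n_gt0) lcD lc_sum.
rewrite lcZ -[X in _ + _ * lc X]expr1 lcX; congr (_ + _).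
rewrite [RHS](eq_bigl (fun mu : {ffun 'I_n.+1 -> 'I_n.+1} => (mu ord0 == 0%N :> nat) &&
  (\sum_(i < n.+1) i * mu i == n)%N)) // [RHS]big_mkcondr.
apply: eq_bigr => mu _; rewrite -rmorphXz ?unitfE // lcZ lcX.
by case: (_ == n); rewrite ?mulr1 ?mulr0.
Qed.

(** The arguments are [b] times the signs [(1, 1, -1, -1)] of [G(-1)] plus [d] times the signs
    [(1, -1, 1, -1)] of [G('i)]. *)
Lemma theta4_coef b d :
  ratr (theta4 (b + d) (b - d) (d - b) (- b - d) n) =
  4^-1 * (ratr b * crank_coef n (-1) + ratr d * crank_coef n 'i).
Proof.
have II : cst 'i * cst 'i = -1 by rewrite -rmorphM -expr2 sqrCi rmorphN1.
rewrite -lc_trunc.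
have [X0 [X1 [X2 [X3 [-> B C]]]]] :=
  @trunc_theta4 _ (cst \o (ratr : rat -> algC)) _ _ _ xn0 (ltn0Sn n) II
    (b + d) (b - d) (d - b) (- b - d).
rewrite -!lc_crank_gf ?neq0Ci ?oppr_eq0 ?oner_eq0 // rmorphN1 B C.
rewrite -lcZ -lcZ -lcD -lcZ; congr lc.
have r4 : ratr (1 / 4) = 4^-1 :> algC by rewrite mul1r fmorphV rmorph_nat.
rewrite /= r4 !(rmorphD, rmorphN).
by congr (_ * _); ring.
Qed.

Lemma crank_coefNi : crank_coef n (- 'i) = crank_coef n 'i.
Proof.
have II : cst 'i * cst 'i = -1 by rewrite -rmorphM -expr2 sqrCi rmorphN1.
have II' : cst (- 'i) * cst (- 'i) = -1 by rewrite rmorphN mulrNN.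
rewrite -!lc_crank_gf ?oppr_eq0 ?neq0Ci //.
by rewrite (crank_gf_I xn0 II) (crank_gf_I xn0 II').
Qed.
End CoefficientExtraction.

(** * Truncated polynomials over the algebraic numbers *)

Section TruncatedPolynomials.
Variable n : nat.
Local Notation T := {poly %/ ('X^(n.+1) : {poly algC})}.
Let x : T := in_qpoly _ 'X.
Let cst : {rmorphism algC -> T} := qpolyC ('X^(n.+1) : {poly algC}).
Let lc (p : T) : algC := (p : {poly algC})`_n.

Let lc_in p : lc (in_qpoly _ p) = p`_n.
Proof.
rewrite /lc /in_qpoly /= mk_monic_Xn -Pdiv.RingMonic.take_poly_rmodp.
by rewrite coef_take_poly ltnSn.
Qed.

Let cstE w : cst w = in_qpoly _ w%:P.
Proof.
apply: val_inj; symmetry; apply: in_qpoly_small.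
exact: leq_ltn_trans (size_polyC_leq1 _) (size_mk_monic_gt1 _).
Qed.

(** Hides the quotient construction behind the four facts that coefficient extraction relies on. *)
Lemma truncated_series_ring :
  exists (A : comUnitRingType) (y : A) (c : {rmorphism algC -> A}) (coef : A -> algC),
  [/\ y ^+ n.+1 = 0, {morph coef : p q / p + q},
      forall w p, coef (c w * p) = w * coef p &
      forall k, coef (y ^+ k) = (k == n)%:R].
Proof.
exists T, x, cst, lc; split=> [|p q|w p|k].
- rewrite -rmorphXn; apply: val_inj; rewrite /= mk_monic_Xn /=.
  by rewrite -Pdiv.RingMonic.take_poly_rmodp -['X^_]mul1r take_polyMXn_0.
- by rewrite /lc poly_of_qpolyD coefD.
- have -> : p = in_qpoly _ (p : {poly algC}).
    by apply: val_inj; symmetry; apply: in_qpoly_small; apply: size_mk_monic.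
  by rewrite cstE -rmorphM !lc_in coefCM.
- by rewrite -rmorphXn lc_in coefXn eq_sym.
Qed.
End TruncatedPolynomials.

Lemma expz_mod4 (w : algC) (d : int) : w ^+ 4 = 1 -> w ^ d = w ^ (d %% 4)%Z.
Proof.
move=> w4; have wu : w \is a GRing.unit.
  by apply/unitrPr; exists (w ^+ 3); rewrite -exprS.
by rewrite {1}(divz_eq d 4) exprzDr // mulrC mulrC (mulrC _ 4) -exprz_exp -exprnP w4
  exp1rz mul1r.
Qed.

(** Orthogonality of the fourth roots of unity: the right side sums [w^(k-a)] over all of them. *)
Lemma cong4_filter (k a : int) : (cong k a 4)%:R * 4 =
  1 + 'i ^ (- a) * 'i ^ k + (-1) ^ (- a) * (-1) ^ k + (- 'i) ^ (- a) * (- 'i) ^ k :> algC.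
Proof.
have i4 : 'i ^+ 4 = 1 :> algC by rewrite (exprM _ 2 2) sqrCi sqrrN expr1n.
have Ni4 : (- 'i) ^+ 4 = 1 :> algC by rewrite (exprM _ 2 2) sqrrN sqrCi sqrrN expr1n.
have N14 : (-1) ^+ 4 = 1 :> algC by rewrite (exprM _ 2 2) sqrrN !expr1n.
rewrite -!expfzDr ?oppr_eq0 ?neq0Ci ?oner_eq0 // [- a + k]addrC.
rewrite (expz_mod4 _ i4) (expz_mod4 _ Ni4) (expz_mod4 _ N14) /cong.
have : ((k - a) %% 4)%Z \in [:: 0; 1; 2; 3].
  rewrite !inE; lia.
have ii := sqrCi algC; rewrite expr2 in ii.
rewrite !inE => /or4P[] /eqP -> /=; rewrite -!exprnP ?expr0 ?expr1 ?sqrrN ?sqrCi ?expr1n;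
  rewrite ?(exprS _ 2) ?sqrrN ?sqrCi ?expr1n; ring.
Qed.

Lemma CaM_filter n (a : int) : (CaM a 4 n)%:~R * 4 =
  (npart n)%:R + 'i ^ (- a) * crank_coef n 'i + (-1) ^ (- a) * crank_coef n (-1)
   + (- 'i) ^ (- a) * crank_coef n (- 'i) :> algC.
Proof.
have iV : 'i^-1 = - 'i :> algC by exact: invCi.
rewrite /CaM; case: n => [|[|n]] /=.
- by rewrite npart0 -[(_ : int)%:~R]/((cong 0 a 4)%:R) cong4_filter !expr0z.
(* The exceptional cranks 1, -1 and 0 enter with signs [1 + 1 - 1], so the root 1 contributes
   [npart 1 = 1]. *)
- rewrite npart1 intrB intrD !pmulrn mulrBl mulrDl -!pmulrn !cong4_filter.
  rewrite !expr0z !expr1z !exprN1; ring.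
rewrite -pmulrn /npart -!sum1_card !natr_sum mulr_suml !mulr_sumr.
rewrite (eq_bigl (fun mu => is_ptn mu && cong (crank mu) a 4)); last by move=> mu; rewrite inE.
rewrite big_mkcondr.
rewrite [\sum_(i in _) 1](eq_bigl (fun mu => is_ptn mu)); last by move=> mu; rewrite inE.
rewrite -!big_split /=; apply: eq_bigr => mu _.
rewrite -cong4_filter; case: cong; rewrite ?mul1r ?mul0r //.
Qed.

Lemma DC_coef n (a : int) : ratr (DC a 4 n) =
  4^-1 * ('i ^ (- a) * crank_coef n 'i + (-1) ^ (- a) * crank_coef n (-1)
   + (- 'i) ^ (- a) * crank_coef n 'i) :> algC.
Proof.
have n4 : 4 \is a @GRing.unit algC by rewrite unitfE pnatr_eq0.
have -> : ratr (DC a 4 n) = (CaM a 4 n)%:~R - (npart n)%:R / 4 :> algC.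
  by rewrite /DC rmorphB fmorph_div rmorph_int !rmorph_nat.
apply: (mulIr n4); rewrite mulrBl mulrVK // CaM_filter.
have [A [x [c [coef [xn0 coefD coefZ coefX]]]]] := truncated_series_ring n.
rewrite (crank_coefNi xn0 coefD coefZ coefX).
rewrite [RHS]mulrAC mulVr // mul1r; ring.
Qed.

Theorem theorem1p5 :
  DC 0 4 = theta4 3 (-1) 1 (-3) /\
  DC 1 4 = theta4 (-1) (-1) 1 1 /\
  DC 3 4 = theta4 (-1) (-1) 1 1 /\
  DC 2 4 = theta4 (-1) 3 (-3) 1.
Proof.
have main (a : int) (b d : rat) :
    (forall n, 'i ^ (- a) * crank_coef n 'i + (-1) ^ (- a) * crank_coef n (-1)
       + (- 'i) ^ (- a) * crank_coef n 'i
     = ratr b * crank_coef n (-1) + ratr d * crank_coef n 'i) ->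
    DC a 4 = theta4 (b + d) (b - d) (d - b) (- b - d).
  move=> E; apply: functional_extensionality => n; apply: (fmorph_inj (ratr : rat -> algC)).
  have [A [x [c [coef [xn0 coefD coefZ coefX]]]]] := truncated_series_ring n.
  by rewrite /= DC_coef E (theta4_coef xn0 coefD coefZ coefX).
have iV : 'i^-1 = - 'i :> algC by exact: invCi.
have NiV : (- 'i)^-1 = 'i :> algC by rewrite invrN iV opprK.
(* Here [b = (-1)^(-a)] and [d = 'i^(-a) + (-'i)^(-a)]; the arguments of [theta4] then agree by
   computation. *)
split; [apply: (main 0 1 2) | split; [apply: (main 1 (-1) 0) |
  split; [apply: (main 3 (-1) 0)|apply: (main 2 1 (-2))]]] => n.
- rewrite oppr0 !expr0z rmorph1 rmorph_nat; ring.
- rewrite !exprN1 iV NiV invrN1 rmorphN1 rmorph0; ring.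
- rewrite -!exprnN -!exprVn iV NiV invrN1 !exprS expr0 rmorphN1 rmorph0.
  have ii := mulCii algC; ring: ii.
- rewrite -!exprnN -!exprVn iV NiV invrN1 sqrrN sqrCi sqrrN expr1n rmorph1 rmorphN rmorph_nat.
  ring.
Qed.
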